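(* Let $(M,g,S)$ be a four-dimensional Riemannian manifold with a skew-circulant structure $S$ (as defined in the context) whose curvature tensor satisfies $R(Sx,Sy,Sz,Su)=R(x,y,z,u)$ for all $x,y,z,u$. Let $p\in M$. If vectors $x,u,v,w\in T_pM$ induce $S$-bases of $T_pM$, $\{S^{3}x,S^{2}x,Sx,x\}$ is an orthonormal basis, and $\angle(u,Su)=\varphi$, $\angle(v,Sv)=\frac{\pi}{3}$, $\angle(w,Sw)=\frac{2\pi}{3}$, then $$\begin{aligned}2(1-\cos^{2}\varphi)\,k(u,Su)+k(u,S^{2}u)={}&(1-4\cos^{2}\varphi)\big(2k(x,Sx)+k(x,S^{2}x)\big)\\&+(2\cos^{2}\varphi+\cos\varphi)\Big(\tfrac{3}{2}k(v,Sv)+k(v,S^{2}v)\Big)\\&+(2\cos^{2}\varphi-\cos\varphi)\Big(\tfrac{3}{2}k(w,Sw)+k(w,S^{2}w)\Big).\end{aligned}$$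
   Context: Throughout, $(M,g,S)$ denotes a $4$-dimensional differentiable manifold $M$ with a Riemannian metric $g$ and a tensor $S$ of type $(1,1)$ whose components with respect to the local basis $\{e_1,e_2,e_3,e_4\}$ form the right skew-circulant matrix $$(S_i^j)=\begin{pmatrix}0&1&0&0\\ 0&0&1&0\\ 0&0&0&1\\ -1&0&0&0\end{pmatrix},\qquad Se_i=S_i^j e_j,$$ so $S^4=-\mathrm{id}$. $S$ is assumed to be an isometry: $g(Sx,Sy)=g(x,y)$. Consequently the components $g_{ij}=g(e_i,e_j)$ are $$(g_{ij})=\begin{pmatrix} A & B & 0 & -B \\ B & A & B & 0 \\ 0 & B & A & B \\ -B & 0 & B & A \end{pmatrix}$$ with smooth functions $A,B$, where it is supposed that $A>\sqrt2\,B>0$ (so $g$ is positive definite). Here $x,y,z,u$ are arbitrary smooth vector fields on $M$ or vectors in a tangent space $T_pM$. $\nabla$ is the Levi-Civita connection of $g$, $R(x,y)z=\nabla_x\nabla_y z-\nabla_y\nabla_x z-\nabla_{[x,y]}z$, and $R(x,y,z,u)=g(R(x,y)z,u)$. For linearly independent $x,y\in T_pM$ the sectional curvature of the $2$-plane $\{x,y\}$ is, with the sign convention used here, $$k(x,y)=\frac{R(x,y,x,y)}{g(x,x)g(y,y)-g^2(x,y)}.$$ A vector $x\in T_pM$ induces an $S$-basis of $T_pM$ if $\{S^3x,S^2x,Sx,x\}$ is a basis of $T_pM$. Angles and orthonormality are with respect to $g$. *)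

(* Defs.v *)
From HB Require Import structures.
From mathcomp Require Import all_boot all_order all_algebra.
From mathcomp Require Import all_classical all_reals all_analysis.

Set Implicit Arguments.
Unset Strict Implicit.
Unset Printing Implicit Defensive.

Import Order.TTheory GRing.Theory Num.Theory.
Import numFieldNormedType.Exports.

Local Open Scope classical_set_scope.
Local Open Scope ring_scope.

(* Points and tangent vectors of R^n are row vectors, so that the differential
   of [f] at [x] is [v |-> v *m jacobian f x]. *)

Definition partial (R : realType) (n : nat) (V : normedModType R)
    (i : 'I_n) (f : 'rV[R]_n -> V) : 'rV[R]_n -> V :=
  fun x => 'D_(delta_mx 0 i) f x.

(* C^oo: the partial derivatives of every order exist and are (totally)
   differentiable, hence continuous, at every point of the open set U. *)
Definition smooth_on (R : realType) (n : nat) (V : normedModType R)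
    (U : set 'rV[R]_n) (f : 'rV[R]_n -> V) : Prop :=
  forall (s : seq 'I_n) (x : 'rV[R]_n),
    U x -> differentiable (foldr (@partial R n V) f s) x.

Definition lie_deriv (R : realType) (n : nat) (V : normedModType R)
    (X : 'rV[R]_n -> 'rV[R]_n) (f : 'rV[R]_n -> V) : 'rV[R]_n -> V :=
  fun x => \sum_(i < n) X x 0 i *: partial i f x.

Definition lie_bracket (R : realType) (n : nat)
    (X Y : 'rV[R]_n -> 'rV[R]_n) : 'rV[R]_n -> 'rV[R]_n :=
  fun x => lie_deriv X Y x - lie_deriv Y X x.

Record chart (R : realType) (n : nat) (M : topologicalType) := Chart {
  chart_dom : set M;
  chart_map : M -> 'rV[R]_n;
  chart_inv : 'rV[R]_n -> M;
  open_chart_dom : open chart_dom;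
  open_chart_img : open (chart_map @` chart_dom);
  chart_mapK : {in chart_dom, cancel chart_map chart_inv};
  chart_map_continuous : {in chart_dom, continuous chart_map};
  chart_inv_continuous :
    {in chart_map @` chart_dom, continuous chart_inv} }.

Record manifold (R : realType) (n : nat) := Manifold {
  points :> topologicalType;
  points_hausdorff : hausdorff_space points;
  points_second_countable : @second_countable points;
  atlas : Type;
  atlas_chart : atlas -> chart R n points;
  atlas_cover : forall p : points, exists c, chart_dom (atlas_chart c) p;
  atlas_smooth : forall c c' : atlas,
    smooth_on
      (chart_map (atlas_chart c) @`
        (chart_dom (atlas_chart c) `&` chart_dom (atlas_chart c')))
      (chart_map (atlas_chart c') \o chart_inv (atlas_chart c)) }.

Section Charts.
Variables (R : realType) (n : nat) (M : manifold R n).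

Definition dom (c : atlas M) : set M := chart_dom (atlas_chart c).
Definition coords (c : atlas M) : M -> 'rV[R]_n := chart_map (atlas_chart c).
Definition img (c : atlas M) : set 'rV[R]_n := coords c @` dom c.
Definition overlap (c c' : atlas M) : set 'rV[R]_n :=
  coords c @` (dom c `&` dom c').
Definition transition (c c' : atlas M) : 'rV[R]_n -> 'rV[R]_n :=
  coords c' \o chart_inv (atlas_chart c).

End Charts.

(* Tensor fields are given by their components in every chart of the atlas,
   with the transformation law.  For a chart [c] with [dom c p], the tangent
   space T_pM is identified with R^n through the coordinate basis of [c]. *)
Record riemannian_metric (R : realType) (n : nat) (M : manifold R n) :=
  RiemannianMetric {
    metric_comp :> atlas M -> 'rV[R]_n -> 'M[R]_n;
    metric_smooth : forall c, smooth_on (img c) (metric_comp c);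
    metric_sym : forall c x, img c x -> (metric_comp c x)^T = metric_comp c x;
    metric_pos : forall c x (v : 'rV[R]_n), img c x -> v != 0 ->
      0 < (v *m metric_comp c x *m v^T) 0 0;
    metric_change : forall c c' x, overlap c c' x ->
      let J := jacobian (transition c c') x in
      metric_comp c x = J *m metric_comp c' (transition c c' x) *m J^T }.

(* Type (1,1): the row i of the matrix is the image of the i-th coordinate
   vector, so that the tensor sends v to [v *m endo_comp c x]. *)
Record endo_field (R : realType) (n : nat) (M : manifold R n) := EndoField {
  endo_comp :> atlas M -> 'rV[R]_n -> 'M[R]_n;
  endo_smooth : forall c, smooth_on (img c) (endo_comp c);
  endo_change : forall c c' x, overlap c c' x ->
    let J := jacobian (transition c c') x in
    endo_comp c x *m J = J *m endo_comp c' (transition c c' x) }.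

(* Affine connection: [conn_comp c x i j] is the vector
   nabla_{d_i} d_j = Gamma_{ij}^k d_k at the point x of the chart c. *)
Record connection (R : realType) (n : nat) (M : manifold R n) := Connection {
  conn_comp :> atlas M -> 'rV[R]_n -> 'I_n -> 'I_n -> 'rV[R]_n;
  conn_smooth : forall c i j, smooth_on (img c) (fun x => conn_comp c x i j);
  conn_change : forall c c' x i j, overlap c c' x ->
    let t := transition c c' in
    conn_comp c x i j *m jacobian t x =
      partial i (partial j t) x +
      \sum_(a < n) \sum_(b < n)
        (partial i t x 0 a * partial j t x 0 b) *: conn_comp c' (t x) a b }.

Section Geometry.
Variables (R : realType) (n : nat) (M : manifold R n).
Implicit Types (g : riemannian_metric M) (D : connection M) (c : atlas M).

Definition inner g c (q x y : 'rV[R]_n) : R := (x *m g c q *m y^T) 0 0.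

Definition nabla D c (X Y : 'rV[R]_n -> 'rV[R]_n) : 'rV[R]_n -> 'rV[R]_n :=
  fun q => lie_deriv X Y q +
    \sum_(i < n) \sum_(j < n) (X q 0 i * Y q 0 j) *: D c q i j.

Definition levi_civita g D : Prop :=
  forall c (X Y Z : 'rV[R]_n -> 'rV[R]_n),
    smooth_on (img c) X -> smooth_on (img c) Y -> smooth_on (img c) Z ->
    forall q, img c q ->
      nabla D c X Y q - nabla D c Y X q = lie_bracket X Y q /\
      lie_deriv X (fun q' => inner g c q' (Y q') (Z q')) q =
        inner g c q (nabla D c X Y q) (Z q) +
        inner g c q (Y q) (nabla D c X Z q).

Definition curvature D c (X Y Z : 'rV[R]_n -> 'rV[R]_n) :
    'rV[R]_n -> 'rV[R]_n :=
  fun q => nabla D c X (nabla D c Y Z) q - nabla D c Y (nabla D c X Z) q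
           - nabla D c (lie_bracket X Y) Z q.

(* R(x,y,z,u) for tangent vectors at the point q of the chart c.  As the
   curvature is tensorial, the vectors may be extended by arbitrary fields;
   those with constant components in c are used. *)
Definition Rm g D c (q x y z u : 'rV[R]_n) : R :=
  inner g c q (curvature D c (fun=> x) (fun=> y) (fun=> z) q) u.

Definition sectional g D c (q x y : 'rV[R]_n) : R :=
  Rm g D c q x y x y /
  (inner g c q x x * inner g c q y y - inner g c q x y ^+ 2).

Definition angle g c (q x y : 'rV[R]_n) : R :=
  acos (inner g c q x y /
        (Num.sqrt (inner g c q x x) * Num.sqrt (inner g c q y y))).

End Geometry.

Definition mx4 (R : realType) (rows : seq (seq R)) : 'M[R]_4 :=
  \matrix_(i < 4, j < 4) (nth [::] rows i)`_j.

Definition skew_circulant_mx (R : realType) : 'M[R]_4 :=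
  mx4 [:: [::  0; 1; 0; 0];
          [::  0; 0; 1; 0];
          [::  0; 0; 0; 1];
          [:: -1; 0; 0; 0]].

Definition gram_mx (R : realType) (A B : R) : 'M[R]_4 :=
  mx4 [:: [::  A; B; 0; -B];
          [::  B; A; B;  0];
          [::  0; B; A;  B];
          [:: -B; 0; B;  A]].

(* The rows of [e q] are the vectors e_1, ..., e_4 of a smooth local frame,
   not necessarily a coordinate one, defined on a neighbourhood V of the
   given point of the chart. *)
Record skew_circulant_structure (R : realType) (M : manifold R 4)
    (g : riemannian_metric M) (S : endo_field M) : Prop := {
  skew_circulant_frame : forall (c : atlas M) (p : M), dom c p ->
    exists (V : set 'rV[R]_4) (e : 'rV[R]_4 -> 'M[R]_4)
           (A B : 'rV[R]_4 -> R),
      [/\ open V, V (coords c p) & V `<=` img c] /\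
      [/\ smooth_on V e, smooth_on V A & smooth_on V B] /\
      forall q, V q ->
        [/\ e q \in unitmx,
            e q *m S c q = skew_circulant_mx R *m e q,
            e q *m g c q *m (e q)^T = gram_mx (A q) (B q),
            Num.sqrt 2 * B q < A q & 0 < B q];
  skew_circulant_isometry : forall (c : atlas M) (q x y : 'rV[R]_4),
    img c q -> inner g c q (x *m S c q) (y *m S c q) = inner g c q x y }.

Definition Spow (R : realType) (M : manifold R 4) (S : endo_field M)
    (c : atlas M) (q : 'rV[R]_4) (k : nat) (x : 'rV[R]_4) : 'rV[R]_4 :=
  iter k (fun y => y *m S c q) x.

Definition S_family (R : realType) (M : manifold R 4) (S : endo_field M)
    (c : atlas M) (q x : 'rV[R]_4) : seq 'rV[R]_4 :=
  [:: Spow S c q 3 x; Spow S c q 2 x; Spow S c q 1 x; x].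

Definition induces_S_basis (R : realType) (M : manifold R 4)
    (S : endo_field M) (c : atlas M) (q x : 'rV[R]_4) : Prop :=
  basis_of fullv (S_family S c q x).

Definition orthonormal_seq (R : realType) (n : nat) (M : manifold R n)
    (g : riemannian_metric M) (c : atlas M) (q : 'rV[R]_n)
    (s : seq 'rV[R]_n) : Prop :=
  forall i j, (i < size s)%N -> (j < size s)%N ->
    inner g c q s`_i s`_j = (i == j)%:R.

(* Main.v *)
Require Import Defs.
From HB Require Import structures.
From mathcomp Require Import all_boot all_order all_algebra.
From mathcomp Require Import all_classical all_reals all_analysis.
From mathcomp Require Import ring lra.
Import Order.TTheory GRing.Theory Num.Theory.
Import numFieldNormedType.Exports.
Local Open Scope classical_set_scope.
Local Open Scope ring_scope.

Set Implicit Arguments.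
Unset Strict Implicit.

(** At a point q let T be the curvature (0,4)-tensor and, for a tangent vector
   u, put N = g(u,u) and t = g(u,Su).  Because S is an isometry with S^4 = -1, we
   have g(u,S^2u) = 0, so that with C = cos(u,Su) = t/N
     2(1 - C^2) k(u,Su) + k(u,S^2u)
        = (2 T(u,Su,u,Su) + T(u,S^2u,u,S^2u)) / N^2.
   The heart of the matter is that the quartic form in the numerator is
   al N^2 + be N t + ga t^2 with constants al, be, ga not depending on u
   (curvature_quadratic).  The left-hand side of the theorem is hence
   al + be C + ga C^2 (sectional_quadratic), and the theorem is the Lagrange
   interpolation of this quadratic polynomial of C at C = 0, 1/2, -1/2, the
   values taken at x, v and w.

   The quartic form is so rigid for the following reason.  Let e_k = S^k x with
   x the vector of the orthonormal S-basis.  On bivectors S permutes without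
   signs the basis made of a 4-cycle E_k = e_k ^ e_(k+1) and a 2-cycle
   G_k = e_k ^ e_(k+2), since e_(k+4) = - e_k.  An S-invariant bilinear form on
   bivectors therefore depends on index differences only, which leaves ten
   constants, and for each of them the polynomial that multiplies it is a
   combination of N^2, N t and t^2.  Equivalently, let z1, z2 and their
   conjugates be the coordinates of u along the eigenlines of S.  The invariant
   products of two bivector coordinates of u ^ Su or of u ^ S^2u are monomials
   in |z1|^2 and |z2|^2, which are combinations of N and t, except for
   (z1 z2)^2 and its conjugate; the weight 2 on T(u,Su,u,Su) is the one that
   cancels these two.

   The argument uses T as a form on pairs of bivectors, so antisymmetry in
   either pair of arguments is needed.  The first is visible from the
   definition; the second (Rm_anti34) is compatibility of the connection with
   the metric, differentiated once more, together with the symmetry of the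
   second derivatives of the smooth function g(z,u) (derive_comm). *)

(** * Symmetry of second derivatives *)

Lemma is_derive_line (R : realType) (V W : normedModType R) (f : V -> W)
    (a v : V) (s : R) :
  differentiable f (a + s *: v) ->
  is_derive s 1 (fun r : R => f (a + r *: v)) ('D_v f (a + s *: v)).
Proof.
move=> fd.
have E : (fun h : R => h^-1 *: (f (a + (h *: 1 + s) *: v) - f (a + s *: v))) =
    (fun h : R => h^-1 *: (f (h *: v + (a + s *: v)) - f (a + s *: v))).
  apply/funext => h; congr (_ *: (f _ - _)).
  by rewrite scalerDl addrCA; congr (_ *: _ + _); exact: mulr1.
apply: DeriveDef; last by rewrite /derive /= E.
by rewrite /derivable /= E; exact: diff_derivable.
Qed.

(** The mixed second difference is a first difference in the direction [v] of
   the difference in the direction [w], so the mean value theorem rewrites it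
   with ['D_v f], whose differentiability at [a] gives the [w]-derivative.  As
   the second difference is symmetric in [v] and [w], it compares the two mixed
   derivatives. *)
Lemma second_difference_le (R : realType) (V : normedModType R) (f : V -> R)
    (a v w : V) (e : R) :
  (\forall y \near a, differentiable f y) ->
  differentiable ('D_v f) a -> 0 < e ->
  \forall t \near (0 : R)^'+,
    `|f (a + t *: v + t *: w) - f (a + t *: v) - f (a + t *: w) + f a
      - t ^+ 2 * 'D_w ('D_v f) a| <= e * t ^+ 2.
Proof.
move=> fd hd e0.
pose h : V -> R := 'D_v f.
have C0 : 0 < 2 * (`|v| + `|w| + 1) by rewrite mulr_gt0// ltr_wpDl// addr_ge0.
(* The two points compared below are within t * C / 2 of [a]; so each linear
   approximation may cost e / C per unit of length. *)
pose C := 2 * (`|v| + `|w| + 1).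
have : \forall k \near (0 : V), differentiable f (a + k) /\
    `|h (a + k) - h a - 'd h a k| <= e / C * `|k|.
  apply: filterS2; last first.
  - have /eqaddoP/(_ (e / C)) := diff_locally hd.
    by move=> /(_ (divr_gt0 e0 C0)); exact.
  - move: fd; rewrite (near_shift 0) => fd'.
    exact: fd'.
  move=> k /= + H; rewrite subr0 addrC => kd; split=> //.
  move: H; rewrite /cst /= !fctE /= [k + a]addrC.
  by rewrite opprD addrA.
move=> /nbhs_normP [r /= r0 rP].
have {}rP k : `|k| < r -> differentiable f (a + k) /\
    `|h (a + k) - h a - 'd h a k| <= e / C * `|k|.
  by move=> kr; apply: rP; rewrite /ball_/= sub0r normrN.
near=> t.
have t0 : 0 < t by near: t; exact: nbhs_right_gt.
have tC : t * C < r.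
  by rewrite -ltr_pdivlMr//; near: t; apply: nbhs_right_lt; rewrite divr_gt0.
have small s (b : R) : 0 <= s <= t -> 0 <= b <= 1 ->
    `|s *: v + (b * t) *: w| <= t * (`|v| + `|w| + 1).
  move=> /andP[s0 st] /andP[b0 b1]; rewrite (le_trans (ler_normD _ _))//.
  rewrite !normrZ !ger0_norm ?mulr_ge0 ?(ltW t0)// !mulrDr mulr1.
  apply: (le_trans (y := t * `|v| + t * `|w|)); last by rewrite lerDl ltW.
  by rewrite lerD// ler_wpM2r// ler_piMl// ltW.
have Cr : t * (`|v| + `|w| + 1) < r.
  rewrite (le_lt_trans _ tC)// ler_wpM2l ?(ltW t0)// /C.
  by rewrite ler_peMl// ?addr_ge0// ler1n.
pose phi s : R := f (a + t *: w + s *: v) - f (a + s *: v).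
have phid s : 0 <= s <= t ->
    is_derive s 1 phi (h (a + t *: w + s *: v) - h (a + s *: v)).
  move=> st; apply: is_deriveB; apply: is_derive_line.
  - have := small s 1 st; rewrite ler01 lexx mul1r => /(_ isT) H.
    by have [+ _] := rP _ (le_lt_trans H Cr); rewrite addrA addrAC.
  - have := small s 0 st; rewrite ler01 lexx mul0r scale0r addr0 => /(_ isT) H.
    by have [+ _] := rP _ (le_lt_trans H Cr).
have [||xi xit E] := @MVT R phi
    (fun s => h (a + t *: w + s *: v) - h (a + s *: v)) 0 t t0.
- by move=> s; rewrite in_itv/= => /andP[s0 st]; apply: phid; rewrite !ltW.
- apply: derivable_within_continuous => s; rewrite in_itv/= => st.
  by have [] := phid s st.
have xit' : 0 <= xi <= t.
  by move: xit; rewrite in_itv/= => /andP[? ?]; rewrite !ltW.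
have [_ H1] : differentiable f (a + (xi *: v + t *: w)) /\
   `|h (a + (xi *: v + t *: w)) - h a - 'd h a (xi *: v + t *: w)|
     <= e / C * `|xi *: v + t *: w|.
  apply: rP; have := small xi 1 xit'.
  by rewrite ler01 lexx mul1r => /(_ isT) H; exact: le_lt_trans Cr.
have [_ H2] : differentiable f (a + xi *: v) /\
   `|h (a + xi *: v) - h a - 'd h a (xi *: v)| <= e / C * `|xi *: v|.
  apply: rP; have := small xi 0 xit'.
  rewrite ler01 lexx mul0r scale0r addr0 => /(_ isT) H.
  exact: le_lt_trans Cr.
have N1 : `|xi *: v + t *: w| <= t * C / 2.
  rewrite /C -mulrA [2 * _]mulrC mulfK//.
  by have := small xi 1 xit'; rewrite ler01 lexx mul1r; exact.
have N2 : `|xi *: v| <= t * C / 2.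
  rewrite /C -mulrA [2 * _]mulrC mulfK//.
  by have := small xi 0 xit'; rewrite ler01 lexx mul0r scale0r addr0; exact.
have -> : f (a + t *: v + t *: w) - f (a + t *: v) - f (a + t *: w) + f a
    = phi t - phi 0.
  by rewrite /phi !scale0r !addr0 [a + t *: w + _]addrAC opprB addrA addrAC.
rewrite E subr0 deriveE//.
have D1 : 'd h a (xi *: v + t *: w) = 'd h a (xi *: v) + t * 'd h a w.
  by rewrite linearD [X in _ + X]linearZ.
move: H1; rewrite D1 addrA [a + xi *: v + _]addrAC => H1.
have eC : e / C * (t * C / 2) = e * t / 2.
  by field; rewrite gt_eqF.
have B1 : e / C * `|xi *: v + t *: w| <= e * t / 2.
  by rewrite -eC ler_wpM2l// divr_ge0// ltW.
have B2 : e / C * `|xi *: v| <= e * t / 2.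
  by rewrite -eC ler_wpM2l// divr_ge0// ltW.
set p : R := h (a + t *: w + xi *: v) in H1 *.
set q : R := h (a + xi *: v) in H2 *.
have -> : (p - q) * t - t ^+ 2 * 'd h a w =
   ((p - h a - ('d h a (xi *: v) + t * 'd h a w)) -
    (q - h a - 'd h a (xi *: v))) * t.
  by ring.
rewrite normrM (gtr0_norm t0) expr2 mulrA ler_wpM2r// ?(ltW t0)//.
rewrite (le_trans (ler_normB _ _))// (splitr (e * t)) lerD//.
- exact: le_trans B1.
- exact: le_trans B2.
Unshelve. all: by end_near. Qed.

(** Divided by t^2, the second difference tends to both mixed derivatives.  This
   takes differentiability of the first derivatives at the point only. *)
Lemma derive_comm (R : realType) (V : normedModType R) (f : V -> R)
    (a v w : V) :
  (\forall y \near a, differentiable f y) ->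
  differentiable ('D_v f) a -> differentiable ('D_w f) a ->
  'D_w ('D_v f) a = 'D_v ('D_w f) a.
Proof.
move=> fd hv hw; apply/eqP; rewrite -subr_eq0 -normr_le0.
apply/ler_addgt0Pr => e e0; rewrite add0r.
have e2 : 0 < e / 2 by rewrite divr_gt0.
have [t [[H1 H2] t0]] := filter_ex (filterI (filterI
  (second_difference_le w fd hv e2)
  (second_difference_le v fd hw e2)) (nbhs_right_gt 0)).
move: H1 H2; rewrite [a + t *: w + _]addrAC.
set X := 'D_w ('D_v f) a; set Y := 'D_v ('D_w f) a.
move: (f _) (f _) (f _) (f _) X Y => p q r s X Y H1 H2.
rewrite -(ler_pM2r (exprn_gt0 2 t0)).
rewrite -[X in _ * X <= _](gtr0_norm (exprn_gt0 2 t0)) -normrM.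
have -> : (X - Y) * t ^+ 2 =
    (s - q - r + p - t ^+ 2 * Y) - (s - r - q + p - t ^+ 2 * X) by ring.
rewrite (le_trans (ler_normB _ _))// [e in leRHS]splitr mulrDl.
exact: lerD H2 H1.
Qed.

(** * Derivatives of matrix expressions *)

Lemma near_eq_differentiable (R : realType) (V W : normedModType R)
    (f h : V -> W) (a : V) :
  (\near a, f a = h a) -> differentiable h a -> differentiable f a.
Proof.
move=> fh /[dup] hd /diff_locallyP[dc hE].
have fE : f \o shift a = cst (f a) + 'd h a +o_ 0 id.
  apply/eqaddoP => e e0.
  have /eqaddoP/(_ e e0) H := hE.
  have : \forall k \near (0 : V), f (k + a) = h (k + a).
    by move: fh; rewrite (near_shift 0) subr0.
  apply: filterS2 H => k /= + E.
  by rewrite /cst /= !fctE /= E (nbhs_singleton fh).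
apply/diff_locallyP; rewrite (diff_unique dc fE); split => //.
Qed.

Lemma is_derive_mulmx (R : realType) (V : normedModType R) (m n p : nat)
    (A : V -> 'M[R]_(m, n)) (B : V -> 'M[R]_(n, p)) (a v : V) :
  derivable A a v -> derivable B a v ->
  is_derive a v (fun x => A x *m B x) ('D_v A a *m B a + A a *m 'D_v B a).
Proof.
move=> Ad Bd.
have H i j : is_derive a v (fun x => (A x *m B x) i j)
    (('D_v A a *m B a + A a *m 'D_v B a) i j).
  have -> : (fun x => (A x *m B x) i j) =
      \sum_k ((fun x => A x i k) * (fun x => B x k j)).
    by apply/funext => x; rewrite mxE fct_sumE.
  rewrite !mxE -big_split/=.
  apply: is_derive_sum => k.
  have A1 := (derivable_mxP A a v).1 Ad i k.
  have B1 := (derivable_mxP B a v).1 Bd k j.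
  have -> : ('D_v A a) i k = 'D_v (fun x => A x i k) a.
    by rewrite (derive_mx Ad) mxE.
  have -> : ('D_v B a) k j = 'D_v (fun x => B x k j) a.
    by rewrite (derive_mx Bd) mxE.
  have := is_deriveM (derivableP A1) (derivableP B1).
  by rewrite /GRing.scale/= addrC [B a k j * _]mulrC.
have D : derivable (fun x => A x *m B x) a v.
  apply/derivable_mxP => i j; exact: (@ex_derive _ _ _ _ _ _ _ (H i j)).
apply: DeriveDef => //; rewrite derive_mx//; apply/matrixP => i j.
by rewrite mxE; have [_ ->] := H i j.
Qed.

Lemma differentiable_mx_entry (R : realType) (V : normedModType R) (m n : nat)
    (A : V -> 'M[R]_(m, n)) (a : V) i j :
  differentiable A a -> differentiable (fun x => A x i j) a.
Proof.
move=> Ad.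
exact: (differentiable_comp Ad (differentiable_coord (A a) i j)).
Qed.

Lemma differentiable_form (R : realType) (V : normedModType R) (m n : nat)
    (A : V -> 'M[R]_(m, n)) (y : 'rV[R]_m) (z : 'rV[R]_n) (a : V) :
  differentiable A a -> differentiable (fun x => (y *m A x *m z^T) 0 0) a.
Proof.
move=> Ad.
have -> : (fun x => (y *m A x *m z^T) 0 0) =
    \sum_(j < n) \sum_(i < m) ((y 0 i * z 0 j) *: (fun x => A x i j)).
  apply/funext => x; rewrite mxE fct_sumE; apply: eq_bigr => j _.
  rewrite fct_sumE !mxE mulr_suml; apply: eq_bigr => i _.
  by rewrite mulrAC.
apply: differentiable_sum => j; apply: differentiable_sum => i.
by apply: differentiableZ; exact: differentiable_mx_entry.
Qed.

Lemma is_derive_form (R : realType) (V : normedModType R) (m n : nat)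
    (A : V -> 'M[R]_(m, n)) (Y : V -> 'rV[R]_m) (Z : V -> 'rV[R]_n) (a v : V) :
  derivable A a v -> derivable Y a v -> derivable Z a v ->
  is_derive a v (fun x => (Y x *m A x *m (Z x)^T) 0 0)
    (('D_v Y a *m A a *m (Z a)^T) 0 0 + (Y a *m 'D_v A a *m (Z a)^T) 0 0 +
     (Y a *m A a *m ('D_v Z a)^T) 0 0).
Proof.
move=> Ad Yd Zd.
have Td : derivable (fun x => (Z x)^T) a v.
  apply/derivable_mxP => i j.
  rewrite (_ : (fun x => _) = fun x => Z x j i).
    exact: (derivable_mxP Z a v).1.
  by apply/funext => x; rewrite mxE.
have TE : 'D_v (fun x => (Z x)^T) a = ('D_v Z a)^T.
  rewrite !derive_mx//; apply/matrixP => i j; rewrite !mxE; congr ('D_v _ a).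
  by apply/funext => x; rewrite mxE.
have H1 := is_derive_mulmx Yd Ad.
have [H1d H1E] := H1.
have [H2d H2E] := is_derive_mulmx H1d Td.
have Fd := (derivable_mxP _ a v).1 H2d 0 0.
apply: DeriveDef => //.
move/matrixP/(_ 0 0): H2E; rewrite derive_mx// mxE => ->.
by rewrite H1E TE mulmxDl !mxE.
Qed.

(** * Algebraic symmetries of the curvature tensor *)

Lemma lie_deriv_dir (R : realType) (n : nat) (V : normedModType R)
    (f : 'rV[R]_n -> V) (a x : 'rV[R]_n) :
  differentiable f a -> lie_deriv (fun=> x) f a = 'D_x f a.
Proof.
move=> fd; rewrite deriveE// [in RHS](row_sum_delta x) linear_sum.
by apply: eq_bigr => i _; rewrite linearZ /partial deriveE.
Qed.

Lemma lie_deriv_cst (R : realType) (n : nat) (V : normedModType R)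
    (X : 'rV[R]_n -> 'rV[R]_n) (k : V) : lie_deriv X (fun=> k) = fun=> 0.
Proof.
apply/funext => q; rewrite /lie_deriv big1// => i _.
by rewrite /partial derive_cst scaler0.
Qed.

Lemma smooth_on_cst (R : realType) (n : nat) (V : normedModType R)
    (U : set 'rV[R]_n) (k : V) : smooth_on U (fun=> k).
Proof.
move=> s x _.
suff [k' ->] : exists k', foldr (@partial R n V) (fun=> k) s = cst k'.
  exact: differentiable_cst.
elim: s => [|i s [k' IH]] /=; first by exists k.
exists 0; rewrite IH; apply/funext => y.
by rewrite /partial derive_cst.
Qed.

Section Curvature.
Variables (R : realType) (n : nat) (M : manifold R n).
Variables (g : riemannian_metric M) (D : connection M) (c : atlas M).
Implicit Types q x y z u : 'rV[R]_n.

(** The covariant derivative along [x] of the field with constant components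
   [y] (nabla_cst_cst). *)
Definition christoffel q x y : 'rV[R]_n :=
  \sum_(i < n) \sum_(j < n) (x 0 i * y 0 j) *: D c q i j.

Lemma christoffel_linearl q a x x' y :
  christoffel q (a *: x + x') y = a *: christoffel q x y + christoffel q x' y.
Proof.
rewrite /christoffel scaler_sumr -big_split; apply: eq_bigr => i _ /=.
rewrite scaler_sumr -big_split; apply: eq_bigr => j _ /=.
by rewrite !mxE scalerA -scalerDl mulrDl mulrA.
Qed.

Lemma christoffel_linearr q a x y y' :
  christoffel q x (a *: y + y') = a *: christoffel q x y + christoffel q x y'.
Proof.
rewrite /christoffel scaler_sumr -big_split; apply: eq_bigr => i _ /=.
rewrite scaler_sumr -big_split; apply: eq_bigr => j _ /=.
by rewrite !mxE scalerA -scalerDl mulrDr [x 0 i * (a * _)]mulrCA.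
Qed.

Lemma inner_linearl q a x x' y :
  inner g c q (a *: x + x') y = a * inner g c q x y + inner g c q x' y.
Proof. by rewrite /inner !mulmxDl -!scalemxAl !mxE. Qed.

Lemma inner_linearr q a x y y' :
  inner g c q x (a *: y + y') = a * inner g c q x y + inner g c q x y'.
Proof. by rewrite /inner linearD linearZ /= mulmxDr -scalemxAr !mxE. Qed.

Lemma inner_sym q x y : img c q -> inner g c q x y = inner g c q y x.
Proof.
move=> qc; rewrite /inner; set A := x *m g c q *m y^T.
have -> : A 0 0 = A^T 0 0 by rewrite [RHS]mxE.
by rewrite /A !trmx_mul trmxK (Defs.metric_sym g qc) mulmxA.
Qed.

Lemma open_img : open (img c). Proof. exact: open_chart_img. Qed.

Lemma near_img q (P : 'rV[R]_n -> Prop) :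
  img c q -> (forall q', img c q' -> P q') -> \forall q' \near q, P q'.
Proof.
move=> qc H; have := open_nbhs_nbhs (conj open_img qc).
exact: filterS.
Qed.

Lemma christoffel_differentiable q x y : img c q ->
  differentiable (fun q' => christoffel q' x y) q.
Proof.
move=> qc; rewrite (_ : (fun _ => _) =
    \sum_(i < n) \sum_(j < n) ((x 0 i * y 0 j) *: (fun q' => D c q' i j))).
  apply: differentiable_sum => i; apply: differentiable_sum => j.
  apply: differentiableZ; exact: (conn_smooth D i j [::] qc).
apply/funext => q'; rewrite fct_sumE; apply: eq_bigr => i _.
by rewrite fct_sumE.
Qed.

Lemma nabla_cst x Y q : differentiable Y q ->
  nabla D c (fun=> x) Y q = 'D_x Y q + christoffel q x (Y q).
Proof. by move=> Yd; rewrite /nabla lie_deriv_dir. Qed.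

Lemma nabla_cst_cst x y :
  nabla D c (fun=> x) (fun=> y) = fun q => christoffel q x y.
Proof. by apply/funext => q; rewrite /nabla lie_deriv_cst add0r. Qed.

(** The second covariant derivative of a constant field, whose
   antisymmetrization in [x] and [y] is the curvature: constant fields have zero
   Lie bracket. *)
Definition nabla2_cst q x y z : 'rV[R]_n :=
  'D_x (fun q' => christoffel q' y z) q + christoffel q x (christoffel q y z).

Lemma curvature_cst q x y z : img c q ->
  curvature D c (fun=> x) (fun=> y) (fun=> z) q =
  nabla2_cst q x y z - nabla2_cst q y x z.
Proof.
move=> qc; rewrite /curvature !nabla_cst_cst.
rewrite !nabla_cst; try exact: christoffel_differentiable.
rewrite [X in _ - X](_ : _ = 0) ?subr0//.
have -> : lie_bracket (fun=> x) (fun=> y) = fun=> 0 :> 'rV[R]_n.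
  by apply/funext => q'; rewrite /lie_bracket !lie_deriv_cst subrr.
rewrite nabla_cst_cst /christoffel big1// => i _; rewrite big1// => j _.
by rewrite mxE mul0r scale0r.
Qed.

Lemma nabla2_cst_linear1 q a x x' y z : img c q ->
  nabla2_cst q (a *: x + x') y z =
    a *: nabla2_cst q x y z + nabla2_cst q x' y z.
Proof.
move=> qc; rewrite /nabla2_cst christoffel_linearl !deriveE;
  try exact: christoffel_differentiable.
by rewrite linearP scalerDr addrACA.
Qed.

Lemma derive_affine q v a (f1 f2 f : 'rV[R]_n -> 'rV[R]_n) :
  differentiable f1 q -> differentiable f2 q ->
  (forall q', f q' = a *: f1 q' + f2 q') ->
  'D_v f q = a *: 'D_v f1 q + 'D_v f2 q.
Proof.
move=> d1 d2 E; have -> : f = (a *: f1) + f2 by apply/funext => q'; rewrite E.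
rewrite deriveD ?deriveZ//; last exact: diff_derivable.
- exact: diff_derivable.
- exact/derivableZ/diff_derivable.
Qed.

Lemma nabla2_cst_linear2 q a x y y' z : img c q ->
  nabla2_cst q x (a *: y + y') z =
    a *: nabla2_cst q x y z + nabla2_cst q x y' z.
Proof.
move=> qc; rewrite /nabla2_cst christoffel_linearl christoffel_linearr.
rewrite (@derive_affine q x a (fun q' => christoffel q' y z)
  (fun q' => christoffel q' y' z)).
- by rewrite scalerDr addrACA.
- exact: christoffel_differentiable.
- exact: christoffel_differentiable.
- by move=> q'; rewrite christoffel_linearl.
Qed.

Lemma nabla2_cst_linear3 q a x y z z' : img c q ->
  nabla2_cst q x y (a *: z + z') =
    a *: nabla2_cst q x y z + nabla2_cst q x y z'.
Proof.
move=> qc; rewrite /nabla2_cst !christoffel_linearr.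
rewrite (@derive_affine q x a (fun q' => christoffel q' y z)
  (fun q' => christoffel q' y z')).
- by rewrite scalerDr addrACA.
- exact: christoffel_differentiable.
- exact: christoffel_differentiable.
- by move=> q'; rewrite christoffel_linearr.
Qed.

Lemma RmE q x y z u : img c q ->
  Rm g D c q x y z u = inner g c q (nabla2_cst q x y z - nabla2_cst q y x z) u.
Proof. by move=> qc; rewrite /Rm curvature_cst. Qed.

Lemma innerBl q x y z :
  inner g c q (x - y) z = inner g c q x z - inner g c q y z.
Proof. by rewrite addrC -scaleN1r inner_linearl mulN1r addrC. Qed.

Lemma Rm_linear1 q a x x' y z u : img c q ->
  Rm g D c q (a *: x + x') y z u = a * Rm g D c q x y z u + Rm g D c q x' y z u.
Proof.
move=> qc; rewrite !RmE// nabla2_cst_linear1// nabla2_cst_linear2//.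
by rewrite !innerBl !inner_linearl; ring.
Qed.

Lemma Rm_linear3 q a x y z z' u : img c q ->
  Rm g D c q x y (a *: z + z') u = a * Rm g D c q x y z u + Rm g D c q x y z' u.
Proof.
move=> qc; rewrite !RmE// !nabla2_cst_linear3//.
by rewrite !innerBl !inner_linearl; ring.
Qed.

Lemma Rm_anti12 q x y z u : img c q ->
  Rm g D c q y x z u = - Rm g D c q x y z u.
Proof. by move=> qc; rewrite !RmE// !innerBl opprB. Qed.

Hypothesis gD : levi_civita g D.

(** The hypothesis on the connection speaks of smooth fields; constant ones
   already express the derivative of the metric by the connection, and all
   further Leibniz rules follow from this pointwise identity. *)
Lemma metric_compatible q v z u : img c q ->
  (z *m 'D_v (g c) q *m u^T) 0 0 =
    inner g c q (christoffel q v z) u + inner g c q z (christoffel q v u).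
Proof.
move=> qc.
have [_] := gD (smooth_on_cst v) (smooth_on_cst z) (smooth_on_cst u) qc.
rewrite !nabla_cst_cst => <-.
have gd : differentiable (g c) q by exact: (metric_smooth g (c := c) [::] qc).
rewrite lie_deriv_dir; last exact: differentiable_form.
have := is_derive_form (@diff_derivable _ _ _ _ _ v gd)
  (derivable_cst z q v) (derivable_cst u q v).
move=> [_ ->]; rewrite !derive_cst.
by rewrite !mul0mx trmx0 mulmx0 !mxE add0r addr0.
Qed.

Lemma is_derive_inner q v (Z U : 'rV[R]_n -> 'rV[R]_n) : img c q ->
  differentiable Z q -> differentiable U q ->
  is_derive q v (fun q' => inner g c q' (Z q') (U q'))
    (inner g c q ('D_v Z q + christoffel q v (Z q)) (U q) +
     inner g c q (Z q) ('D_v U q + christoffel q v (U q))).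
Proof.
move=> qc Zd Ud.
have gd : differentiable (g c) q by exact: (metric_smooth g (c := c) [::] qc).
have := is_derive_form (@diff_derivable _ _ _ _ _ v gd)
  (@diff_derivable _ _ _ _ _ v Zd) (@diff_derivable _ _ _ _ _ v Ud).
rewrite metric_compatible// => H.
apply: is_derive_eq H _.
rewrite -[in RHS](scale1r ('D_v Z q)) -[in RHS](scale1r ('D_v U q)).
by rewrite inner_linearl inner_linearr !mul1r /inner; ring.
Qed.

Lemma differentiable_derive_inner q v z u : img c q ->
  differentiable ('D_v (fun q' => inner g c q' z u)) q.
Proof.
move=> qc.
apply: (@near_eq_differentiable _ _ _ _
  (\sum_(i < n) (v 0 i *: (fun q' => (z *m partial i (g c) q' *m u^T) 0 0)))).
  apply: (near_img qc) => q' q'c.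
  have gd : differentiable (g c) q'.
    exact: (metric_smooth g (c := c) [::] q'c).
  rewrite -lie_deriv_dir; last exact: differentiable_form.
  rewrite fct_sumE; apply: eq_bigr => i _; congr (_ *: _).
  rewrite /partial; set e := delta_mx 0 i.
  have := is_derive_form (@diff_derivable _ _ _ _ _ e gd)
    (derivable_cst z q' e) (derivable_cst u q' e).
  move=> [_ ->]; rewrite !derive_cst.
  by rewrite !mul0mx trmx0 mulmx0 !mxE add0r addr0.
apply: differentiable_sum => i; apply: differentiableZ.
apply: differentiable_form.
exact: (metric_smooth g (c := c) [:: i] qc).
Qed.

Lemma derive2_inner q x y z u : img c q ->
  'D_x ('D_y (fun q' => inner g c q' z u)) q =
  inner g c q (nabla2_cst q x y z) u + inner g c q z (nabla2_cst q x y u) +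
  (inner g c q (christoffel q y z) (christoffel q x u) +
   inner g c q (christoffel q x z) (christoffel q y u)).
Proof.
move=> qc.
have E : {near q, 'D_y (fun q' => inner g c q' z u) =1
  (fun q' => inner g c q' (christoffel q' y z) u) +
  (fun q' => inner g c q' z (christoffel q' y u))}.
  apply: (near_img qc) => q' q'c.
  have := is_derive_inner y q'c
    (differentiable_cst z q') (differentiable_cst u q').
  by move=> [_ ->]; rewrite !derive_cst !add0r.
rewrite (near_eq_derive _ E).
have H1 := is_derive_inner x qc
  (christoffel_differentiable y z qc) (differentiable_cst u q).
have H2 := is_derive_inner x qc
  (differentiable_cst z q) (christoffel_differentiable y u qc).
have [_ ->] := is_deriveD H1 H2.
by rewrite /cst /= !derive_cst !add0r /nabla2_cst; ring.
Qed.

(** In the second derivative of g(z,u) along [x] and [y] the last two terms of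
   derive2_inner are symmetric in [x] and [y]; since the derivatives commute,
   the difference leaves g(R(x,y)z,u) + g(z,R(x,y)u) = 0. *)
Lemma Rm_anti34 q x y z u : img c q ->
  Rm g D c q x y u z = - Rm g D c q x y z u.
Proof.
move=> qc; rewrite !RmE// !innerBl.
have C : 'D_x ('D_y (fun q' => inner g c q' z u)) q =
    'D_y ('D_x (fun q' => inner g c q' z u)) q.
  apply: derive_comm; try exact: differentiable_derive_inner.
  apply: (near_img qc) => q' q'c; apply: differentiable_form.
  exact: (metric_smooth g (c := c) [::] q'c).
move: C; rewrite !derive2_inner//.
rewrite (inner_sym z _ qc) (inner_sym z (nabla2_cst q y x u) qc); lra.
Qed.

End Curvature.

(** * Curvature tensors invariant under a skew-circulant isometry *)

(** Vectors and coefficients are indexed by natural numbers rather than by four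
   indices, so that the orbit e_0, Se_0, S^2e_0, ... can be continued past e_3,
   where e_4 = - e_0. *)
Definition lincomb4 (R : realType) (V : lmodType R)
    (e : nat -> V) (a : nat -> R) : V :=
  \sum_(i < 4) a i *: e i.

Section AlternatingForm.
Variables (R : realType) (V : lmodType R) (B : V -> V -> R).
Hypothesis Blin : forall a x x' y, B (a *: x + x') y = a * B x y + B x' y.
Hypothesis Balt : forall x y, B y x = - B x y.

(** Expansion of a bivector in the basis adapted to S; e_0 ^ e_3 is written as
   e_3 ^ e_4, to which it is equal, so that the four terms B(e_k, e_(k+1)) form
   one orbit of S. *)
Lemma alternating_lincomb4 (e : nat -> V) (a b : nat -> R) : e 4%N = - e 0%N ->
  let w i j := a i * b j - a j * b i in
  B (lincomb4 e a) (lincomb4 e b) =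
    w 0%N 1%N * B (e 0%N) (e 1%N) + w 1%N 2%N * B (e 1%N) (e 2%N) +
    w 2%N 3%N * B (e 2%N) (e 3%N) + w 0%N 3%N * B (e 3%N) (e 4%N) +
    w 0%N 2%N * B (e 0%N) (e 2%N) + w 1%N 3%N * B (e 1%N) (e 3%N).
Proof.
rewrite /lincomb4 => e4 /=.
have B0 y : B 0 y = 0.
  by have := Blin (-1) 0 0 y; rewrite scaler0 addr0; lra.
have Bsum (f : nat -> R) y :
    B (\sum_(i < 4) f i *: e i) y = \sum_(i < 4) f i * B (e i) y.
  rewrite !big_ord_recr !big_ord0 /= !add0r -!addrA !Blin.
  by rewrite -[_ *: _]addr0 Blin B0 addr0 !addrA.
have Bxx x : B x x = 0 by have := Balt x x; lra.
have Bsumr x : B x (\sum_(i < 4) b i *: e i) = \sum_(i < 4) b i * B x (e i).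
  rewrite Balt Bsum -sumrN; apply: eq_bigr => i _.
  by rewrite [B (e i) x]Balt mulrN opprK.
have B34 : B (e 3%N) (e 4%N) = B (e 0%N) (e 3%N).
  rewrite e4 [LHS]Balt -scaleN1r -[-1 *: _]addr0 Blin B0.
  by rewrite mulN1r addr0 opprK.
transitivity (\sum_(i < 4) a i * \sum_(j < 4) b j * B (e i) (e j)).
  by rewrite Bsum; apply: eq_bigr => i _; rewrite Bsumr.
rewrite B34 !big_ord_recr !big_ord0 /= !Bxx.
rewrite (Balt (e 0%N) (e 1%N)) (Balt (e 0%N) (e 2%N)) (Balt (e 0%N) (e 3%N)).
rewrite (Balt (e 1%N) (e 2%N)) (Balt (e 1%N) (e 3%N)) (Balt (e 2%N) (e 3%N)).
ring.
Qed.

End AlternatingForm.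

Section SkewCirculantCurvature.
Variables (R : realType) (V : lmodType R) (T : V -> V -> V -> V -> R).
Hypothesis Tlin1 : forall z u a x x' y,
  T (a *: x + x') y z u = a * T x y z u + T x' y z u.
Hypothesis Talt12 : forall z u x y, T y x z u = - T x y z u.
Hypothesis Tlin3 : forall x y a z z' u,
  T x y (a *: z + z') u = a * T x y z u + T x y z' u.
Hypothesis Talt34 : forall x y z u, T x y u z = - T x y z u.
Variable s : V -> V.
Hypothesis Tinv : forall x y z u, T (s x) (s y) (s z) (s u) = T x y z u.
Hypothesis s_linear : forall a x y, s (a *: x + y) = a *: s x + s y.
Hypothesis s4 : forall x, s (s (s (s x))) = - x.

(** The action of S on coordinates in the basis e_0, ..., e_3. *)
Definition skew_shift (a : nat -> R) (i : nat) : R :=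
  if i is i'.+1 then a i' else - a 3%N.

Variable e : nat -> V.
Hypothesis eS : forall k, e k.+1 = s (e k).

Lemma skew_map0 : s 0 = 0.
Proof. by have := s_linear (-1) 0 0; rewrite scaler0 addr0 scaleN1r addNr. Qed.

Lemma orbit4 k : e k.+4 = - e k. Proof. by rewrite !eS s4. Qed.

Lemma skew_map_lincomb4 a : s (lincomb4 e a) = lincomb4 e (skew_shift a).
Proof.
rewrite /lincomb4 !big_ord_recr !big_ord0 /= !add0r -!addrA !s_linear.
rewrite -[a 3%N *: _]addr0 s_linear skew_map0 addr0 -!eS (orbit4 0).
rewrite scalerN scaleNr.
by rewrite [RHS]addrC -!addrA.
Qed.

Lemma T_orbit_shift i j k l :
  T (e i.+1) (e j.+1) (e k.+1) (e l.+1) = T (e i) (e j) (e k) (e l).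
Proof. by rewrite !eS Tinv. Qed.

Lemma T1N x y z u : T (- x) y z u = - T x y z u.
Proof.
have T0 : T 0 y z u = 0.
  by have := Tlin1 z u (-1) 0 0 y; rewrite scaler0 addr0; lra.
by rewrite -scaleN1r -[_ *: _]addr0 Tlin1 T0 addr0 mulN1r.
Qed.

Lemma T12_period4 k z u : T (e k.+4) (e k.+4.+1) z u = T (e k) (e k.+1) z u.
Proof. by rewrite !orbit4 T1N Talt12 T1N Talt12 !opprK. Qed.

Lemma T12_period2 k z u : T (e k.+2) (e k.+4) z u = T (e k) (e k.+2) z u.
Proof. by rewrite orbit4 Talt12 T1N opprK. Qed.

Lemma T3N x y z u : T x y (- z) u = - T x y z u.
Proof.
have T0 : T x y 0 u = 0.
  by have := Tlin3 x y (-1) 0 0 u; rewrite scaler0 addr0; lra.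
by rewrite -scaleN1r -[_ *: _]addr0 Tlin3 T0 addr0 mulN1r.
Qed.

Lemma T34_period4 k x y : T x y (e k.+4) (e k.+4.+1) = T x y (e k) (e k.+1).
Proof. by rewrite !orbit4 T3N Talt34 T3N Talt34 !opprK. Qed.

Lemma T34_period2 k x y : T x y (e k.+2) (e k.+4) = T x y (e k) (e k.+2).
Proof. by rewrite orbit4 Talt34 T3N opprK. Qed.

(** Expanding in bivectors, the coefficients E, G, H, H' depend on the indices
   through their difference, modulo 4 when both bivectors lie in the 4-cycle
   and modulo 2 otherwise.  With g0, g1 the coordinates of u ^ Su on the
   2-cycle, P = a_0^2 + a_2^2 and Q = a_1^2 + a_3^2, one has N = P + Q,
   t = g0 + g1 and g0^2 + g1^2 = P Q, and the bivector u ^ S^2u has coordinates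
   (g1, g0, g1, g0) on the 4-cycle and (P, Q) on the 2-cycle.  These identities
   turn the factor of each coefficient into a multiple of N^2, N t or t^2. *)
Lemma curvature_quadratic :
  exists al be ga : R, forall a, let u := lincomb4 e a in
  let N := a 0%N ^+ 2 + a 1%N ^+ 2 + a 2%N ^+ 2 + a 3%N ^+ 2 in
  let t := a 0%N * a 1%N + a 1%N * a 2%N + a 2%N * a 3%N - a 3%N * a 0%N in
  2 * T u (s u) u (s u) + T u (s (s u)) u (s (s u)) =
  al * N ^+ 2 + be * (N * t) + ga * t ^+ 2.
Proof.
pose E k l := T (e k) (e k.+1) (e l) (e l.+1).
pose G k l := T (e k) (e k.+2) (e l) (e l.+2).
pose H k l := T (e k) (e k.+1) (e l) (e l.+2).
pose H' k l := T (e k) (e k.+2) (e l) (e l.+1).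
exists (2 * E 0%N 0%N + G 0%N 0%N).
exists (2 * (H 0%N 0%N + H 0%N 1%N + H' 0%N 0%N + H' 0%N 1%N)).
exists (2 * (E 0%N 1%N + E 0%N 2%N + E 0%N 3%N - E 0%N 0%N + G 0%N 1%N)).
move=> a u N t.
rewrite /u !skew_map_lincomb4.
have X12 b z w := alternating_lincomb4 (Tlin1 z w) (Talt12 z w) a b (orbit4 0).
have X34 b x y := alternating_lincomb4 (Tlin3 x y) (Talt34 x y) a b (orbit4 0).
rewrite !X12 !X34 {X12 X34} !T_orbit_shift.
(* One index is moved forward by a period, after which both can be shifted
   back. *)
have E10 : E 1%N 0%N = E 0%N 3%N by rewrite /E -(T34_period4 0) T_orbit_shift.
have E20 : E 2%N 0%N = E 0%N 2%N by rewrite /E -(T34_period4 0) !T_orbit_shift.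
have E30 : E 3%N 0%N = E 0%N 1%N by rewrite /E -(T34_period4 0) !T_orbit_shift.
have H10 : H 1%N 0%N = H 0%N 1%N by rewrite /H -(T34_period2 0) T_orbit_shift.
have H20 : H 2%N 0%N = H 0%N 0%N by rewrite /H -(T34_period2 0) !T_orbit_shift.
have H30 : H 3%N 0%N = H 0%N 1%N by rewrite /H -(T34_period2 0) !T_orbit_shift.
have H'02 : H' 0%N 2%N = H' 0%N 0%N.
  by rewrite /H' -(T12_period2 0) !T_orbit_shift.
have H'03 : H' 0%N 3%N = H' 0%N 1%N.
  by rewrite /H' -(T12_period2 0) !T_orbit_shift.
have H'10 : H' 1%N 0%N = H' 0%N 1%N.
  by rewrite -H'03 /H' -(T34_period4 0) T_orbit_shift.
have G10 : G 1%N 0%N = G 0%N 1%N by rewrite /G -(T34_period2 0) T_orbit_shift.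
move: E10 E20 E30 H10 H20 H30 H'02 H'03 H'10 G10.
rewrite /E /G /H /H' => -> -> -> -> -> -> -> -> -> ->.
rewrite /N /t /skew_shift.
ring.
Qed.

Variable g : V -> V -> R.
Hypothesis glin : forall a x x' y, g (a *: x + x') y = a * g x y + g x' y.
Hypothesis gsym : forall x y, g x y = g y x.
Hypothesis ginv : forall x y, g (s x) (s y) = g x y.
Hypothesis eO : forall i j,
  (i < 4)%N -> (j < 4)%N -> g (e i) (e j) = (i == j)%:R.

Lemma inner_lincomb4 a b : g (lincomb4 e a) (lincomb4 e b) =
  a 0%N * b 0%N + a 1%N * b 1%N + a 2%N * b 2%N + a 3%N * b 3%N.
Proof.
have g0 y : g 0 y = 0.
  by have := glin (-1) 0 0 y; rewrite scaler0 addr0; lra.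
have gsum (f : nat -> R) y : g (lincomb4 e f) y = \sum_(i < 4) f i * g (e i) y.
  rewrite /lincomb4 !big_ord_recr !big_ord0 /= !add0r -!addrA !glin.
  by rewrite -[_ *: _]addr0 glin g0 addr0 !addrA.
have gsumr y : g y (lincomb4 e b) = \sum_(i < 4) b i * g y (e i).
  by rewrite gsym gsum; apply: eq_bigr => i _; rewrite gsym.
rewrite gsum !big_ord_recr !big_ord0 /= !gsumr.
rewrite !big_ord_recr !big_ord0 /= !eO//=.
by ring.
Qed.

(** The angle between u and Su lies between pi/4 and 3 pi/4, that is
   2 t^2 <= N^2: in particular u and Su are independent and both quotients are genuine
   sectional curvatures.  As Su and S^2u have the length of u, clearing
   denominators gives the quartic form of curvature_quadratic over N^2. *)
Lemma sectional_quadratic :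
  exists al be ga : R, forall a, let u := lincomb4 e a in
    let C := g u (s u) / g u u in
    0 < g u u ->
    [/\ g (s u) (s u) = g u u, -1 <= C <= 1 &
    2 * (1 - C ^+ 2) *
      (T u (s u) u (s u) / (g u u * g (s u) (s u) - g u (s u) ^+ 2)) +
      T u (s (s u)) u (s (s u)) /
        (g u u * g (s (s u)) (s (s u)) - g u (s (s u)) ^+ 2) =
    al + be * C + ga * C ^+ 2].
Proof.
have [al [be [ga Q]]] := curvature_quadratic.
exists al, be, ga => a u C; set N := g u u => N0.
have uu : N = a 0%N ^+ 2 + a 1%N ^+ 2 + a 2%N ^+ 2 + a 3%N ^+ 2.
  by rewrite /N inner_lincomb4; ring.
have usu : g u (s u) =
    a 0%N * a 1%N + a 1%N * a 2%N + a 2%N * a 3%N - a 3%N * a 0%N.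
  by rewrite /u skew_map_lincomb4 inner_lincomb4 /skew_shift; ring.
have ussu : g u (s (s u)) = 0.
  by rewrite /u !skew_map_lincomb4 inner_lincomb4 /skew_shift; ring.
have bound : 2 * g u (s u) ^+ 2 <= N ^+ 2.
  rewrite uu usu.
  (* N^2 - 2 t^2 = (P - Q)^2 + 2 (g0 - g1)^2 *)
  have H1 := sqr_ge0 (a 0%N ^+ 2 + a 2%N ^+ 2 - a 1%N ^+ 2 - a 3%N ^+ 2).
  have H2 := sqr_ge0
    (a 0%N * a 1%N + a 2%N * a 3%N - a 1%N * a 2%N + a 3%N * a 0%N).
  rewrite -subr_ge0; apply: le_trans (addr_ge0 H1 (mulr_ge0 (ler0n R 2) H2)) _.
  rewrite le_eqVlt; apply/orP; left; apply/eqP; ring.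
move: {Q}(Q a) => /=; rewrite -/u -uu -usu => Q.
have N2 : 0 < N ^+ 2 by rewrite exprn_gt0.
split; first exact: ginv.
  rewrite -ler_norml -(ler_pXn2r (n := 2))// ?nnegrE// expr1n.
  rewrite real_normK ?num_real//.
  rewrite /C expr_div_n ler_pdivrMr// mul1r// -/N.
  have := sqr_ge0 (g u (s u)); lra.
rewrite !ginv -/N ussu expr0n subr0 -!expr2.
have -> : 2 * (1 - C ^+ 2) * (T u (s u) u (s u) / (N ^+ 2 - g u (s u) ^+ 2)) +
    T u (s (s u)) u (s (s u)) / N ^+ 2 =
    (2 * T u (s u) u (s u) + T u (s (s u)) u (s (s u))) / N ^+ 2.
  rewrite /C -/N; field; apply/andP; split; first by rewrite gt_eqF.
  rewrite gt_eqF//; have := sqr_ge0 (g u (s u)); lra.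
rewrite Q /C -/N; field.
by rewrite gt_eqF.
Qed.

End SkewCirculantCurvature.

(** * Cosines of the two special angles *)

(** By the triple angle formula c = cos(pi/3) is a root of
   4 c^3 - 3 c + 1 = (c + 1) (2 c - 1)^2, and it is positive. *)
Lemma cos_pi3 (R : realType) : cos (pi / 3 : R) = 1 / 2.
Proof.
set c := cos _.
have c0 : 0 < c.
  apply: cos_gt0_pihalf; have := pi_gt0 R; lra.
have E : cos (pi / 3 + (pi / 3) *+ 2) = - 1 :> R.
  by rewrite -cospi; congr cos; rewrite mulr2n; field.
move: E; rewrite cosD cos_mulr2n sin_mulr2n -/c.
have := cos2Dsin2 (pi / 3 : R); rewrite -/c; set s := sin _ => sc E.
have : (c + 1) * (2 * c - 1) ^+ 2 = 0.
  transitivity (c * (c ^+ 2 *+ 2 - 1) - s * (c * s *+ 2) + 1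
    - 2 * c * (1 - (c ^+ 2 + s ^+ 2))); first by ring.
  by rewrite sc E; ring.
move/eqP; rewrite mulf_eq0 sqrf_eq0 => /orP[] /eqP; lra.
Qed.

Lemma cos_2pi3 (R : realType) : cos (2 * pi / 3 : R) = - (1 / 2).
Proof.
rewrite (_ : 2 * pi / 3 = (- (pi / 3)) + pi); last by field.
by rewrite cosDpi cosN cos_pi3.
Qed.

(** * Bases induced by the structure *)

Lemma skew_circulant_mx4 (R : realType) :
  let K := skew_circulant_mx R in K *m K *m K *m K = - 1%:M.
Proof.
move=> K.
have K2 : K *m K = mx4 [:: [:: 0; 0; 1; 0]; [:: 0; 0; 0; 1];
                           [:: -1; 0; 0; 0]; [:: 0; -1; 0; 0]].
  apply/matrixP => -[[|[|[|[|//]]]] i4] [[|[|[|[|//]]]] j4];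
    rewrite !mxE !big_ord_recr big_ord0 /= !mxE /=; ring.
rewrite -mulmxA K2.
apply/matrixP => -[[|[|[|[|//]]]] i4] [[|[|[|[|//]]]] j4];
    rewrite !mxE !big_ord_recr big_ord0 /= !mxE /= ?eqE/=; ring.
Qed.

Section SBasis.
Variables (R : realType) (M : manifold R 4) (g : riemannian_metric M).
Variables (S : endo_field M) (c : atlas M).

(** In the frame given by the structure S is the skew-circulant matrix, and
   S^4 = -1 does not depend on the frame. *)
Lemma Spow4 (p : M) : skew_circulant_structure g S -> dom c p ->
  forall x, Spow S c (coords c p) 4 x = - x.
Proof.
move=> gS pc x.
have [V [e [A [B [[_ Vp _] [_ H]]]]]] := skew_circulant_frame gS pc.
have [eu eK _ _ _] := H _ Vp.
rewrite /Spow /=; move: (coords c p) eu eK => q eu eK.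
set E := e q in eu eK *; set s := S c q in eK *; pose K := skew_circulant_mx R.
have Es : E *m (s *m s *m s *m s) = - E.
  by rewrite !mulmxA eK -!mulmxA (mulmxA E) eK -!mulmxA (mulmxA E) eK -!mulmxA eK
     !mulmxA skew_circulant_mx4 mulNmx mul1mx.
have -> : x *m s *m s *m s *m s = x *m (s *m s *m s *m s) by rewrite !mulmxA.
by rewrite -(mulKmx eu (s *m s *m s *m s)) Es mulmxN mulVmx// mulmxN mulmx1.
Qed.

Lemma S_basis_lincomb4 q x u : induces_S_basis S c q x ->
  exists a, u = lincomb4 (fun k => Spow S c q k x) a.
Proof.
move=> /span_basis xb; have : u \in <<S_family S c q x>>%VS by rewrite xb memvf.
rewrite /S_family !span_cons span_nil addv0.
move=> /memv_addP[_ /vlineP[a3 ->] [_ /memv_addP[_ /vlineP[a2 ->]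
  [_ /memv_addP[_ /vlineP[a1 ->] [_ /vlineP[a0 ->] ->]]] ->] ->]].
exists (nth 0 [:: a0; a1; a2; a3]).
rewrite /lincomb4 !big_ord_recr big_ord0 /= add0r.
rewrite addrC; congr (_ + _); rewrite addrC; congr (_ + _).
exact: addrC.
Qed.

Lemma S_basis_neq0 q x : induces_S_basis S c q x -> x != 0.
Proof.
move=> /basis_free xf; apply: free_not0 xf _.
by rewrite !inE eqxx !orbT.
Qed.

End SBasis.

(** * The curvature identity *)

Unset Implicit Arguments.
Set Strict Implicit.

Theorem theorem4p3 (R : realType) (M : manifold R 4)
    (g : riemannian_metric M) (S : endo_field M) (D : connection M)
    (gS_skew_circulant : skew_circulant_structure g S)
    (D_levi_civita : levi_civita g D)
    (R_invariant : forall (c : atlas M) (q x y z u : 'rV[R]_4), img c q ->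
      Rm g D c q (x *m S c q) (y *m S c q) (z *m S c q) (u *m S c q) =
      Rm g D c q x y z u)
    (p : M) (c : atlas M) (pc : dom c p) (x u v w : 'rV[R]_4) (phi : R) :
  let q := coords c p in
  let S1 := Spow S c q 1 in
  let S2 := Spow S c q 2 in
  let k := sectional g D c q in
  induces_S_basis S c q x -> induces_S_basis S c q u ->
  induces_S_basis S c q v -> induces_S_basis S c q w ->
  orthonormal_seq g c q (S_family S c q x) ->
  angle g c q u (S1 u) = phi ->
  angle g c q v (S1 v) = pi / 3 ->
  angle g c q w (S1 w) = 2 * pi / 3 ->
  2 * (1 - cos phi ^+ 2) * k u (S1 u) + k u (S2 u) =
    (1 - 4 * cos phi ^+ 2) * (2 * k x (S1 x) + k x (S2 x)) +
    (2 * cos phi ^+ 2 + cos phi) * (3 / 2 * k v (S1 v) + k v (S2 v)) +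
    (2 * cos phi ^+ 2 - cos phi) * (3 / 2 * k w (S1 w) + k w (S2 w)).
Proof.
move=> q S1 S2 k xb ub vb wb xO uphi vphi wphi.
have qc : img c q by exists p.
pose s (y : 'rV[R]_4) := y *m S c q.
pose e (i : nat) := Spow S c q i x.
(* The S-basis is listed from S^3x down to x, hence the reversed indices. *)
have eO i j : (i < 4)%N -> (j < 4)%N -> inner g c q (e i) (e j) = (i == j)%:R.
  move=> i4 j4; have := xO (3 - i)%N (3 - j)%N.
  rewrite !ltnS !leq_subr => /(_ isT isT).
  by move: i j i4 j4 => [|[|[|[|//]]]] [|[|[|[|//]]]].
have s_linear a y z : s (a *: y + z) = a *: s y + s z.
  by rewrite /s mulmxDl scalemxAl.
have [al [be [ga Q]]] := @sectional_quadratic R 'rV[R]_4 (Rm g D c q)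
  (fun z u a x x' y => Rm_linear1 g D a x x' y z u qc)
  (fun z u x y => Rm_anti12 g D x y z u qc)
  (fun x y a z z' u => Rm_linear3 g D a x y z z' u qc)
  (fun x y z u => Rm_anti34 D_levi_civita x y z u qc)
  s (fun x y z u => R_invariant c q x y z u qc)
  s_linear
  (Spow4 gS_skew_circulant pc) e (fun=> erefl)
  (inner g c q) (inner_linearl g c q) (fun x y => inner_sym g x y qc)
  (fun x y => skew_circulant_isometry gS_skew_circulant x y qc) eO.
have F y : induces_S_basis S c q y ->
    let C := cos (angle g c q y (S1 y)) in
    C = inner g c q y (s y) / inner g c q y y /\
    2 * (1 - C ^+ 2) * k y (S1 y) + k y (S2 y) = al + be * C + ga * C ^+ 2.
  move=> yb.
  have N0 : 0 < inner g c q y y by apply: metric_pos qc (S_basis_neq0 yb).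
  have [a ya] := S_basis_lincomb4 y xb.
  move: (Q a); rewrite -/e -ya => /(_ N0) [ss C1 E].
  suff CE : cos (angle g c q y (S1 y)) = inner g c q y (s y) / inner g c q y y.
    by move=> C; rewrite /C CE; split => //; exact: E.
  rewrite /angle (ss : inner g c q (S1 y) (S1 y) = _) -expr2.
  rewrite sqr_sqrtr ?(ltW N0)//.
  by rewrite acosK// in_itv.
have [_ Fu] := F u ub; have [_ Fv] := F v vb; have [_ Fw] := F w wb.
have [Cx Fx] := F x xb.
have {}Cx : cos (angle g c q x (S1 x)) = 0.
  by rewrite Cx (eO 0%N 1%N isT isT : inner g c q x (s x) = _) mul0r.
rewrite uphi in Fu; rewrite vphi cos_pi3 in Fv; rewrite wphi cos_2pi3 in Fw.
rewrite Cx in Fx.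
(* Values of the quadratic polynomial at C = 0, 1/2 and -1/2. *)
have -> : 2 * k x (S1 x) + k x (S2 x) = al by lra.
have -> : 3 / 2 * k v (S1 v) + k v (S2 v) = al + be / 2 + ga / 4 by lra.
have -> : 3 / 2 * k w (S1 w) + k w (S2 w) = al - be / 2 + ga / 4 by lra.
by rewrite Fu; field.
Qed.
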